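(* Let $R$ be a ring, let $e\in R$ satisfy $e^2=e$, and put $f=1-e$. If either $eRf=0$ or $fRe=0$, then $Fe\in\mathcal N(R)$ for every $F\in\mathcal N(R)$.
   Context: All rings are associative with identity. For a ring $R$, $R[x]$ is the polynomial ring in a central indeterminate $x$ (that is, $x$ commutes with the coefficients, which need not commute with each other). For $F(x)=\sum_i c_i x^i\in R[x]$ with $c_i\in R$, the right value of $F$ at $a\in R$ is $F(a)=\sum_i c_i a^i$ (coefficients written on the left of the powers). The set of null polynomials is $\mathcal N(R)=\{F\in R[x]: F(a)=0\text{ for every }a\in R\}$. For $F(x)=\sum_i c_i x^i$ and $e\in R$, $Fe$ denotes the product in $R[x]$ of $F$ with the constant polynomial $e$, i.e. $Fe=\sum_i (c_i e)x^i$. Here $eRf=\{erf: r\in R\}$ and $fRe=\{fre: r\in R\}$. *)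

(* Defs.v *)
From mathcomp Require Import all_boot all_algebra.

Set Implicit Arguments.
Unset Strict Implicit.
Unset Printing Implicit Defensive.

Import GRing.Theory.
Local Open Scope ring_scope.

(* [F.[a]] is the right value \sum_i F`_i * a ^+ i (lemma [horner_coef]), with
   the coefficients on the left; [R] need not be commutative. *)
Definition null_poly (R : nzRingType) (F : {poly R}) : Prop :=
  forall a : R, F.[a] = 0.

(* Main.v *)
(* If g R = g R g, then (g a)^i g = g a^i for all i, so the value of F g at a
   is F(g a) g; hence F g is null whenever F is.  When e R f = 0 this applies
   to g = e; when f R e = 0 it applies to g = f, and then F e = F - F f. *)
Require Import Defs.
From mathcomp Require Import all_boot all_algebra.

Set Implicit Arguments.
Unset Strict Implicit.
Unset Printing Implicit Defensive.

Import GRing.Theory.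
Local Open Scope ring_scope.

Lemma exprM_absorb (R : nzRingType) (g : R)
    (hg : forall r : R, g * r * g = g * r) (a : R) (i : nat) :
  (g * a) ^+ i * g = g * a ^+ i.
Proof.
elim: i => [|i IHi]; first by rewrite !expr0 mul1r mulr1.
(* Induction turns the product into [g * a * g * a ^+ i], where [hg] absorbs the second [g]. *)
by rewrite exprS -mulrA IHi mulrA hg -mulrA -exprS.
Qed.

Lemma horner_mulC_absorb (R : nzRingType) (g : R)
    (hg : forall r : R, g * r * g = g * r) (F : {poly R}) (a : R) :
  (F * g%:P).[a] = F.[g * a] * g.
Proof.
have sFg : (size (F * g%:P)%R <= size F)%N.
  by apply/leq_sizeP => j hj; rewrite coefMC nth_default ?mul0r.
rewrite (horner_coef_wide _ sFg) horner_coef mulr_suml.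
by apply: eq_bigr => i _; rewrite coefMC -!mulrA exprM_absorb.
Qed.

Lemma null_poly_mulC_absorb (R : nzRingType) (g : R)
    (hg : forall r : R, g * r * g = g * r) (F : {poly R}) :
  null_poly F -> null_poly (F * g%:P).
Proof. by move=> F0 a; rewrite horner_mulC_absorb // F0 mul0r. Qed.

Theorem theorem3p1 (R : nzRingType) (e f : R)
    (he : e ^+ 2 = e) (hf : f = 1 - e)
    (hef : (forall r : R, e * r * f = 0) \/ (forall r : R, f * r * e = 0)) :
  forall F : {poly R}, null_poly F -> null_poly (F * e%:P).
Proof.
move=> F F0; case: hef => [eRf0|fRe0].
  apply: null_poly_mulC_absorb F0 => r.
  (* Here [e * r - e * r * e = e * r * (1 - e) = e * r * f]. *)
  by apply/esym/eqP; rewrite -subr_eq0 -{1}[e * r]mulr1 -mulrBr -hf eRf0.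
have eE : e = 1 - f by rewrite hf opprB addrC subrK.
have hfR r : f * r * f = f * r by rewrite {2}hf mulrBr mulr1 fRe0 subr0.
move=> a; rewrite eE polyCB mulrBr mulr1 hornerD hornerN F0.
by rewrite (null_poly_mulC_absorb hfR F0) subr0.
Qed.
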